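(* Let $m=2$ and $d\ge4$. Write $C_{i,\ell}$ for $C^{(2,d)}_{i,\ell}$, and write $r\equiv k$ for $\mathrm{mod}(r,2)=\mathrm{mod}(k,2)$. The connection coefficients satisfy the following equations for all $j\ge1$. (1) Suppose $0\le n\le d-2$. For odd $k$ with $1\le k\le n+1$, $$b^{n,x}_{k,k}C_{2j-1,\ell(n+1,k)}=\beta_{j-1}(w)C_{2j-3,\ell(n,k)}+\alpha_j(w)C_{2j-1,\ell(n,k)}+\beta_j(w)C_{2j+1,\ell(n,k)}-\sum_{\substack{r=k\\ r\equiv k}}^{n}b^{n-1,x}_{k,r}C_{2j-1,\ell(n-1,r)}-\sum_{\substack{r>0\\ r\equiv k}}^{n+1}a^{n,x}_{r,k}C_{2j-1,\ell(n,r)}-\sum_{\substack{r>0\\ r\equiv k}}^{k-2}b^{n,x}_{r,k}C_{2j-1,\ell(n+1,r)};$$ for even $k$ with $2\le k\le n+1$, $$b^{n,x}_{k,k}C_{2j,\ell(n+1,k)}=\beta_{j-2}(\phi w)C_{2j-2,\ell(n,k)}+\alpha_{j-1}(\phi w)C_{2j,\ell(n,k)}+\beta_{j-1}(\phi w)C_{2j+2,\ell(n,k)}-\sum_{\substack{r=k\\ r\equiv k}}^{n}b^{n-1,x}_{k,r}C_{2j,\ell(n-1,r)}-\sum_{\substack{r>0\\ r\equiv k}}^{n+1}a^{n,x}_{r,k}C_{2j,\ell(n,r)}-\sum_{\substack{r>0\\ r\equiv k}}^{k-2}b^{n,x}_{r,k}C_{2j,\ell(n+1,r)}.$$ (2)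 Suppose $0\le n\le d-2$ and $k=n+1$. If $n$ is odd, $$b^{n,y}_{k+1,k}C_{2j-1,\ell(n+1,k+1)}=\sum_{r=j-d+1}^{j+1}r_{r-1,j}C_{2r,\ell(n,k)}-\sum_{\substack{r=\max\{k-1,1\}\\ r\equiv k-1}}^{n}b^{n-1,y}_{k,r}C_{2j-1,\ell(n-1,r)}-\sum_{\substack{r>0\\ r\equiv k-1}}^{n+1}a^{n,y}_{r,k}C_{2j-1,\ell(n,r)}-\sum_{\substack{r>0\\ r\equiv k-1}}^{k-1}b^{n,y}_{r,k}C_{2j-1,\ell(n+1,r)},$$ and if $n$ is even, $$b^{n,y}_{k+1,k}C_{2j,\ell(n+1,k+1)}=\sum_{r=j-1}^{j-1+d}r_{j-1,r}C_{2r-1,\ell(n,k)}-\sum_{\substack{r=\max\{k-1,1\}\\ r\equiv k-1}}^{n}b^{n-1,y}_{k,r}C_{2j,\ell(n-1,r)}-\sum_{\substack{r>0\\ r\equiv k-1}}^{n+1}a^{n,y}_{r,k}C_{2j,\ell(n,r)}-\sum_{\substack{r>0\\ r\equiv k-1}}^{k-1}b^{n,y}_{r,k}C_{2j,\ell(n+1,r)}.$$ (3) Suppose $n=d-1$. For even $k$ with $2\le k\le d$, $$b^{n,y}_{k,k}C_{2j-1,\ell(n+1,k)}=\sum_{r=j-d+1}^{j+1}r_{r-1,j}C_{2r,\ell(n,k)}-\sum_{\substack{r=\max\{k-1,1\}\\ r\equiv k-1}}^{d-1}b^{n-1,y}_{k,r}C_{2j-1,\ell(n-1,r)}-\sum_{\substack{r>0\\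 r\equiv k-1}}^{d}a^{n,y}_{r,k}C_{2j-1,\ell(n,r)}-\sum_{\substack{r>0\\ r\equiv k}}^{k-2}b^{n,y}_{r,k}C_{2j-1,\ell(n+1,r)},$$ and for odd $k$ with $1\le k\le d$, $$b^{n,y}_{k,k}C_{2j,\ell(n+1,k)}=\sum_{r=j-1}^{j-1+d}r_{j-1,r}C_{2r-1,\ell(n,k)}-\sum_{\substack{r=\max\{k-1,1\}\\ r\equiv k-1}}^{d-1}b^{n-1,y}_{k,r}C_{2j,\ell(n-1,r)}-\sum_{\substack{r>0\\ r\equiv k-1}}^{d}a^{n,y}_{r,k}C_{2j,\ell(n,r)}-\sum_{\substack{r>0\\ r\equiv k}}^{k-2}b^{n,y}_{r,k}C_{2j,\ell(n+1,r)}.$$ (4) Suppose $n\ge d$. If either $\mathrm{mod}(n+1-d,2)=1$ and $k$ is odd, or $\mathrm{mod}(n+1-d,2)=0$ and $k$ is even ($1\le k\le d$), then $$b^{n,y}_{k,k}C_{2j-1,\ell(n+1,k)}=\sum_{r=j-d+1}^{j+1}r_{r-1,j}C_{2r,\ell(n,k)}-\sum_{\substack{r=k\\ r\equiv k}}^{d}b^{n-1,y}_{k,r}C_{2j-1,\ell(n-1,r)}-\sum_{\substack{r>0\\ r\equiv k-1}}^{d}a^{n,y}_{r,k}C_{2j-1,\ell(n,r)}-\sum_{\substack{r>0\\ r\equiv k}}^{k-2}b^{n,y}_{r,k}C_{2j-1,\ell(n+1,r)}.$$ If either $\mathrm{mod}(n+1-d,2)=0$ and $k$ is odd, or $\mathrm{mod}(n+1-d,2)=1$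 and $k$ is even ($1\le k\le d$), then $$b^{n,y}_{k,k}C_{2j,\ell(n+1,k)}=\sum_{r=j-1}^{j-1+d}r_{j-1,r}C_{2r-1,\ell(n,k)}-\sum_{\substack{r=k\\ r\equiv k}}^{d}b^{n-1,y}_{k,r}C_{2j,\ell(n-1,r)}-\sum_{\substack{r>0\\ r\equiv k-1}}^{d}a^{n,y}_{r,k}C_{2j,\ell(n,r)}-\sum_{\substack{r>0\\ r\equiv k}}^{k-2}b^{n,y}_{r,k}C_{2j,\ell(n+1,r)}.$$
   Context: Let $w$ be a non-negative weight function whose support is an interval $I=(a,b)$, $(a,\infty)$ or $(-\infty,\infty)$, with all moments finite, and $\phi$ a real polynomial of degree $d$ with $\phi>0$ on $I$ ($\phi$ may vanish at endpoints of $I$). Let $\gamma_{2,d}=\{(x,y):y^2=\phi(x),x\in I\}$; polynomials are considered in $\mathbb{R}[x,y]/\langle y^2-\phi(x)\rangle$ with inner product $$\langle f,g\rangle_{\gamma_{2,d},w}=\int_I\big[f(x,\sqrt{\phi(x)})g(x,\sqrt{\phi(x)})+f(x,-\sqrt{\phi(x)})g(x,-\sqrt{\phi(x)})\big]w(x)\,dx.$$ $p_n(\omega;x)$ is the degree-$n$ orthonormal polynomial with positive leading coefficient with respect to $\langle f,g\rangle_\omega=\int fg\,\omega\,dx$; $\alpha_n(\omega)=\langle xp_n(\omega),p_n(\omega)\rangle_\omega$, $\beta_n(\omega)=\langle xp_n(\omega),p_{n+1}(\omega)\rangle_\omega$ for $n\ge0$, $\beta_{-1}(\omega)=0$; $r_{i,n}=\langle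 p_n(w),p_i(\phi w)\rangle_{\phi w}$ for $i,n\ge0$, and $r_{i,n}=0$ if $i<0$. (The doubly indexed $r_{\cdot,\cdot}$ is distinct from the summation index $r$.) The orthonormal $P$-basis is $P^{(2,d)}_{n,0}=p_n(w;x)/\sqrt2$, $n\ge0$, and $P^{(2,d)}_{n,1}=y\,p_{n-1}(\phi w;x)/\sqrt2$, $n\ge1$. Orthonormal OPs $Y^{(2,d)}_{n,k}$, $n\ge0$, $1\le k\le\min\{n+1,d\}$, are constructed as follows (''orthogonalising $f$'' means subtracting from $f$ its orthogonal projection onto the span of all previously constructed OPs and dividing by the norm of the result). $Y^{(2,d)}_{0,1}=P^{(2,d)}_{0,0}$. For $0\le n\le d-2$: orthogonalise $xY^{(2,d)}_{n,k}$ to get $Y^{(2,d)}_{n+1,k}$, in the order $k=1,\dots,n+1$, then orthogonalise $yY^{(2,d)}_{n,n+1}$ to get $Y^{(2,d)}_{n+1,n+2}$. For $n\ge d-1$: orthogonalise $yY^{(2,d)}_{n,k}$ to get $Y^{(2,d)}_{n+1,k}$, in the order $k=1,\dots,d$. (These are OPs of degree $n$ on $\gamma_{2,d}$: degree meaning the lowest total degree among representatives modulo $y^2-\phi(x)$.) $\ell(n,k)=\frac{n(n+1)}2+k-1$ for $0\le n\le d-1$, $1\le k\le n+1$, and $\ell(n,k)=dn-\frac{d(d-1)}2+k-1$ for $n\ge d$, $1\le k\le d$. The connection coefficients are $C^{(2,d)}_{0,\ell(n,k)}=\langle Y^{(2,d)}_{n,k},P^{(2,d)}_{0,0}\rangle$,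 and for $i\ge1$, $C^{(2,d)}_{2i-1,\ell(n,k)}=\langle Y^{(2,d)}_{n,k},P^{(2,d)}_{i,0}\rangle$, $C^{(2,d)}_{2i,\ell(n,k)}=\langle Y^{(2,d)}_{n,k},P^{(2,d)}_{i,1}\rangle$ (inner products $\langle\cdot,\cdot\rangle_{\gamma_{2,d},w}$). $a^{n,x}_{i,j}=\langle Y^{(2,d)}_{n,i},xY^{(2,d)}_{n,j}\rangle$, $b^{n,x}_{i,j}=\langle Y^{(2,d)}_{n+1,i},xY^{(2,d)}_{n,j}\rangle$, and $a^{n,y}_{i,j},b^{n,y}_{i,j}$ likewise with $y$. Conventions: the row index $-1$ stands for the coefficient of $P^{(2,d)}_{0,0}$, i.e. $C^{(2,d)}_{-1,\ell}:=C^{(2,d)}_{0,\ell}$; empty sums and terms involving level $n-1=-1$ are zero. In sums with lower limit written ''$r>0$'' (or a number) together with a congruence condition, $r$ ranges over the integers satisfying the condition up to the upper limit. *)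

(* Defs.v *)
From HB Require Import structures.
From mathcomp Require Import all_boot all_order all_algebra.
From mathcomp Require Import all_classical all_reals all_analysis.

Set Implicit Arguments.
Unset Strict Implicit.
Unset Printing Implicit Defensive.

Import Order.TTheory GRing.Theory Num.Theory.
Import numFieldNormedType.Exports.

Local Open Scope classical_set_scope.
Local Open Scope ring_scope.

Definition weight_interval (R : realType) (I : set R) : Prop :=
  [\/ exists a b : R, a < b /\ I = `]a, b[%classic,
      exists a : R, I = `]a, +oo[%classic
    | I = setT].

(* Topological support of the measure w(x) dx.  It is closed, so "w has
   support I" is written weight_support w = closure I. *)
Definition weight_support (R : realType) (w : R -> R) : set R :=
  [set x | forall e : R, 0 < e ->
     (0 < \int[@lebesgue_measure R]_(t in ball x e) (w t)%:E)%E].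

Definition weight_on (R : realType) (I : set R) (w : R -> R) : Prop :=
  [/\ measurable_fun setT w,
      forall x, 0 <= w x,
      weight_support w = closure I
    & forall n : nat,
        (@lebesgue_measure R).-integrable I (fun x => (x ^+ n * w x)%:E)].

Definition poly_ip (R : realType) (I : set R) (om : R -> R)
    (f g : {poly R}) : R :=
  \int[@lebesgue_measure R]_(x in I) (f.[x] * g.[x] * om x).

Definition orthonormal_polys (R : realType) (I : set R) (om : R -> R)
    (p : nat -> {poly R}) : Prop :=
  (forall n, size (p n) = n.+1 /\ 0 < lead_coef (p n)) /\
  (forall m n, poly_ip I om (p m) (p n) = (m == n)%:R).

Definition alpha (R : realType) (I : set R) (om : R -> R)
    (p : nat -> {poly R}) (n : nat) : R :=
  poly_ip I om ('X * p n) (p n).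

(* Integer index because of the convention beta_(-1) = 0. *)
Definition beta (R : realType) (I : set R) (om : R -> R)
    (p : nat -> {poly R}) (n : int) : R :=
  match n with
  | Posz n => poly_ip I om ('X * p n) (p n.+1)
  | Negz _ => 0
  end.

Definition times_weight (R : realType) (phi : {poly R}) (w : R -> R) : R -> R :=
  fun x => phi.[x] * w x.

(* r_(i,n) = <p_n(w), p_i(phi w)>_(phi w), where p, q are the orthonormal
   polynomials for w and phi w, and r_(i,n) = 0 for i < 0. *)
Definition rcoef (R : realType) (I : set R) (w : R -> R) (phi : {poly R})
    (p q : nat -> {poly R}) (i : int) (n : nat) : R :=
  match i with
  | Posz i => poly_ip I (times_weight phi w) (p n) (q i)
  | Negz _ => 0
  end.

(* R[x,y]/<y^2 - phi(x)>: R[x,y] is {poly {poly R}}, whose indeterminate 'X is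
   y and whose coefficients are polynomials in x.  The quotient is an algebra
   over {poly R}; a real scalar c acts as c%:P. *)
Definition curve_poly (R : realType) (phi : {poly R}) : {poly {poly R}} :=
  'X ^+ 2 - phi%:P.

Notation curve_ring phi := {poly %/ (curve_poly phi)}.

Definition of_x (R : realType) (phi f : {poly R}) : curve_ring phi :=
  f *: (1 : curve_ring phi).
Definition xvar (R : realType) (phi : {poly R}) : curve_ring phi :=
  of_x phi 'X.
Definition yvar (R : realType) (phi : {poly R}) : curve_ring phi :=
  in_qpoly (curve_poly phi) 'X.

(* Value at (x, y), computed on the canonical representative; for points with
   y^2 = phi(x) it does not depend on the representative. *)
Definition curve_eval (R : realType) (phi : {poly R}) (f : curve_ring phi)
    (x y : R) : R :=
  ((f : {poly {poly R}}).[y%:P]).[x].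

Definition curve_ip (R : realType) (I : set R) (w : R -> R) (phi : {poly R})
    (f g : curve_ring phi) : R :=
  \int[@lebesgue_measure R]_(x in I)
    ((curve_eval f x (Num.sqrt phi.[x]) * curve_eval g x (Num.sqrt phi.[x])
      + curve_eval f x (- Num.sqrt phi.[x])
        * curve_eval g x (- Num.sqrt phi.[x])) * w x).

Definition P0 (R : realType) (phi : {poly R}) (p : nat -> {poly R}) (n : nat) :
    curve_ring phi :=
  of_x phi ((Num.sqrt 2)^-1 *: p n).

(* Only meaningful for 1 <= n. *)
Definition P1 (R : realType) (phi : {poly R}) (q : nat -> {poly R}) (n : nat) :
    curve_ring phi :=
  yvar phi * of_x phi ((Num.sqrt 2)^-1 *: q n.-1).

Definition in_span (R : realType) (phi : {poly R}) (s : seq (curve_ring phi))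
    (g : curve_ring phi) : Prop :=
  exists c : nat -> R, g = \sum_(i < size s) (c i)%:P *: nth 0 s i.

Definition is_projection (R : realType) (I : set R) (w : R -> R)
    (phi : {poly R}) (s : seq (curve_ring phi)) (f g : curve_ring phi) : Prop :=
  in_span s g /\ (forall h, in_span s h -> curve_ip I w (f - g) h = 0).

Definition orthogonalises (R : realType) (I : set R) (w : R -> R)
    (phi : {poly R}) (s : seq (curve_ring phi)) (f e : curve_ring phi) : Prop :=
  exists2 g, is_projection I w s f g &
    e = ((Num.sqrt (curve_ip I w (f - g) (f - g)))^-1)%:P *: (f - g).

(* The list of all Y_(m,i) constructed before Y_(n,k), where level m consists
   of the indices 1 <= i <= min(m+1, d). *)
Definition previous (T : Type) (d : nat) (Y : nat -> nat -> T) (n k : nat) :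
    seq T :=
  [seq Y m i | m <- iota 0 n, i <- iota 1 (minn m.+1 d)]
  ++ [seq Y n i | i <- iota 1 k.-1].

(* Only the values Y n k with 1 <= k <= min(n+1, d) are constrained. *)
Definition Y_construction (R : realType) (I : set R) (w : R -> R)
    (phi : {poly R}) (d : nat) (p : nat -> {poly R})
    (Y : nat -> nat -> curve_ring phi) : Prop :=
  [/\ Y 0%N 1%N = P0 phi p 0,
      forall n k, (n <= d - 2)%N -> (1 <= k <= n.+1)%N ->
        orthogonalises I w (previous d Y n.+1 k) (xvar phi * Y n k) (Y n.+1 k),
      forall n, (n <= d - 2)%N ->
        orthogonalises I w (previous d Y n.+1 n.+2)
          (yvar phi * Y n n.+1) (Y n.+1 n.+2)
    & forall n k, (d - 1 <= n)%N -> (1 <= k <= d)%N ->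
        orthogonalises I w (previous d Y n.+1 k)
          (yvar phi * Y n k) (Y n.+1 k)].

Definition ell (d n k : nat) : nat :=
  if (n < d)%N then ((n * n.+1) %/ 2 + (k - 1))%N
  else (d * n - (d * (d - 1)) %/ 2 + (k - 1))%N.

(* ell d is injective on the indices 1 <= k <= min(n+1, d), so these equations
   are consistent and determine C i (ell d n k) for i >= -1.  The remaining
   values of C are junk. *)
Definition connection_coeffs (R : realType) (I : set R) (w : R -> R)
    (phi : {poly R}) (d : nat) (p q : nat -> {poly R})
    (Y : nat -> nat -> curve_ring phi) (C : int -> nat -> R) : Prop :=
  (forall n k, (1 <= k <= minn n.+1 d)%N ->
     C 0 (ell d n k) = curve_ip I w (Y n k) (P0 phi p 0) /\
     forall i : nat, (1 <= i)%N ->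
       C (2 * i%:Z - 1) (ell d n k) = curve_ip I w (Y n k) (P0 phi p i) /\
       C (2 * i%:Z) (ell d n k) = curve_ip I w (Y n k) (P1 phi q i)) /\
  (forall l, C (- 1) l = C 0 l).

(* a^(n,v)_(i,j) and b^(n,v)_(i,j), for the multiplication by v. *)
Definition acoef (R : realType) (I : set R) (w : R -> R) (phi : {poly R})
    (Y : nat -> nat -> curve_ring phi) (v : curve_ring phi) (n i j : nat) : R :=
  curve_ip I w (Y n i) (v * Y n j).
Definition bcoef (R : realType) (I : set R) (w : R -> R) (phi : {poly R})
    (Y : nat -> nat -> curve_ring phi) (v : curve_ring phi) (n i j : nat) : R :=
  curve_ip I w (Y n.+1 i) (v * Y n j).

(* F lo + F (lo + 1) + ... + F hi, empty if hi < lo. *)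
Definition sumz (V : nmodType) (lo hi : int) (F : int -> V) : V :=
  if lo <= hi then \sum_(0 <= s < `|hi - lo|%N.+1) F (lo + s%:Z) else 0.

(* Main.v *)
Require Import Defs.
From HB Require Import structures.
From mathcomp Require Import all_boot all_order all_algebra.
From mathcomp Require Import all_classical all_reals all_analysis.
From mathcomp Require Import ring zify.

Set Implicit Arguments.
Unset Strict Implicit.
Unset Printing Implicit Defensive.

Import Order.TTheory GRing.Theory Num.Theory.
Import numFieldNormedType.Exports.

Local Open Scope classical_set_scope.
Local Open Scope ring_scope.

(** Every identity compares the coefficients of one expansion: a multiple v * Y n k,
    with v = x or v = y, is written in the orthonormal system formed by the Y m i, and
    both sides are paired with an element P of the P-basis.

    The pairing of f and g depends only on the product f * g: it is twice the moment of
    the part of f * g that is even in y ([curve_ip_moment]).  So the pairing is bilinear,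
    multiplication by x and by y is self-adjoint, and elements of opposite parity in y
    are orthogonal.  Self-adjointness moves v onto P, where the three-term recurrence, or
    the expansion of one orthonormal system of polynomials in the other one, gives the
    terms with alpha, beta and r ([curve_ip_xvar_P0], [curve_ip_xvar_P1],
    [curve_ip_yvar_P0], [curve_ip_yvar_P1]).

    On the other side, v * Y n k lies in the span of the element Y (n+1) K that is
    obtained from it and of the elements constructed earlier.  The levels below n - 1, and the start of level n - 1,
    contribute nothing: the coefficient of Y m i equals the pairing of Y n k with
    v * Y m i, and v * Y m i is in the span of the elements that precede Y n k.  For v = y
    on the levels m <= d - 2 this needs an argument, since there the construction
    multiplies by x: [yvar_Y_in_span_low].  The congruence conditions on r express that
    each Y m i is even or odd in y ([Y_y_parity]).  [Y_recurrence] collects all this, and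
    the four parts of the theorem are its instances.

    If the residue in an orthogonalisation step vanishes, then that step produces 0; an
    orthogonal system of unit vectors and zeros still expands every element of its span
    ([fourier_expansion]). *)

(** * Polynomials orthonormal for a linear functional *)

Section OrthonormalPolynomials.
Variables (R : realType) (M : {scalar {poly R}}) (p : nat -> {poly R}).
Hypothesis size_p : forall n, size (p n) = n.+1.
Hypothesis Mpp : forall m n, M (p m * p n) = (m == n)%:R.

Lemma functional_coord n (c : 'I_n -> R) (i : 'I_n) :
  M ((\sum_(j < n) c j *: p j) * p i) = c i.
Proof.
rewrite mulr_suml linear_sum (bigD1 i) //= -scalerAl linearZ /= Mpp eqxx mulr1.
rewrite big1 ?addr0// => j ji; rewrite -scalerAl linearZ /= Mpp.
by rewrite (inj_eq val_inj) (negPf ji) mulr0.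
Qed.

(** The degrees of the p n are 0, 1, 2, and so on, so the first n of them span the
    polynomials of degree below n; pairing with p i extracts the coefficients. *)
Lemma orthonormal_expansion n (f : {poly R}) : (size f <= n)%N ->
  f = \sum_(i < n) M (f * p i) *: p i.
Proof.
move=> sf; suff [c fE] : exists c : 'I_n -> R, f = \sum_(i < n) c i *: p i.
  by rewrite [LHS]fE; apply: eq_bigr => i _; rewrite fE functional_coord.
elim: n f sf => [|n IHn] f sf.
  exists (fun=> 0); rewrite big_ord0; apply/eqP.
  by rewrite -size_poly_eq0 -leqn0.
pose a := f`_n / (p n)`_n.
have [|c fE] := IHn (f - a *: p n).
  apply/leq_sizeP => i; rewrite leq_eqVlt => /predU1P[<-|ni].
    rewrite coefB coefZ /a divfK ?subrr// -[n in _`_n]/(n.+1.-1) -(size_p n).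
    by rewrite -lead_coefE lead_coef_eq0 -size_poly_eq0 size_p.
  rewrite coefB coefZ (leq_sizeP _ _ sf)// (@nth_default _ _ (p n)) ?size_p//.
  by rewrite mulr0 subr0.
(* The coefficient a cancels the leading term; it becomes the last one. *)
exists (fun i => oapp c a (unlift ord_max i)).
rewrite big_ord_recr /= unlift_none /=; apply/eqP; rewrite -subr_eq; apply/eqP.
rewrite fE; apply: eq_bigr => i _.
rewrite (_ : widen_ord _ i = lift ord_max i) ?liftK//; apply/val_inj.
by rewrite /= /bump leqNgt ltn_ord.
Qed.

Lemma orthonormal_low_degree n (f : {poly R}) : (size f <= n)%N ->
  M (f * p n) = 0.
Proof.
move=> /orthonormal_expansion ->.
rewrite mulr_suml linear_sum big1// => i _.
by rewrite -scalerAl linearZ /= Mpp ltn_eqF ?mulr0.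
Qed.

Lemma functional_sqr f : M (f * f) = \sum_(i < size f) M (f * p i) ^+ 2.
Proof.
rewrite {2}(orthonormal_expansion (leqnn (size f))) mulr_sumr linear_sum.
by apply: eq_bigr => i _; rewrite -scalerAr linearZ.
Qed.

Lemma functional_sqr_ge0 f : 0 <= M (f * f).
Proof. by rewrite functional_sqr sumr_ge0// => i _; rewrite sqr_ge0. Qed.

(** Definiteness comes from the existence of the orthonormal system alone: the value at a
    square is the sum of the squares of the coordinates. *)
Lemma functional_sqr_eq0 f : M (f * f) = 0 -> f = 0.
Proof.
rewrite functional_sqr => /psumr_eq0P f0.
rewrite (orthonormal_expansion (leqnn (size f))) big1// => i _.
by have /eqP := f0 (fun i _ => sqr_ge0 _) i isT; rewrite sqrf_eq0 => /eqP ->; rewrite scale0r.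
Qed.

(** For i < j, the polynomial 'X * p i has degree at most j; this kills all coefficients
    but the last three. *)
Lemma mulX_expansion j :
  'X * p j = (if j is i.+1 then M ('X * p i * p j) *: p i else 0)
    + M ('X * p j * p j) *: p j + M ('X * p j * p j.+1) *: p j.+1.
Proof.
have sX i : size ('X * p i) = i.+2.
  by rewrite mulrC size_mulX ?size_p// -size_poly_eq0 size_p.
rewrite [LHS](@orthonormal_expansion j.+2) ?sX//.
rewrite 2!big_ord_recr /=; congr (_ + _ + _).
case: j => [|j]; first by rewrite big_ord0.
rewrite big_ord_recr /= big1 ?add0r => [|i _].
  by rewrite mulrAC.
by rewrite mulrAC orthonormal_low_degree ?scale0r// sX !ltnS.
Qed.
End OrthonormalPolynomials.

(** * Moments of the weight *)

Lemma weight_interval_measurable (R : realType) (I : set R) :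
  weight_interval I -> measurable I.
Proof.
by case=> [[a [b [_ ->]]]|[a ->]|->]; [exact: measurable_itv..|exact: measurableT].
Qed.

Section Moments.
Variables (R : realType) (I : set R) (w : R -> R).
Hypotheses (mI : measurable I) (hw : weight_on I w).

(** The two proofs are arguments so that the linear structure below is inferred from the
    term. *)
Definition moment_functional (_ : measurable I) (_ : weight_on I w)
    (f : {poly R}) : R :=
  \int[@lebesgue_measure R]_(x in I) (f.[x] * w x).

Lemma integrable_poly_weight (f : {poly R}) :
  (@lebesgue_measure R).-integrable I (EFin \o (fun x => f.[x] * w x)).
Proof.
have [_ _ _ xw] := hw.
have := @eq_integrable _ _ _ (@lebesgue_measure R) I mI
    (fun x => \sum_(i < size f) (f`_i)%:E * (x ^+ i * w x)%:E)%E.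
apply.
  move=> x _; rewrite /= horner_coef mulr_suml -sumEFin.
  by apply: eq_bigr => i _; rewrite -EFinM mulrA.
by apply: integrable_sum => // i _; apply: integrableZl.
Qed.

Lemma moment_functional_linear : scalar (moment_functional mI hw).
Proof.
move=> a f g; rewrite /moment_functional.
have fw := integrable_poly_weight f; have gw := integrable_poly_weight g.
have afw := integrable_poly_weight (a *: f).
rewrite -RintegralZl//.
rewrite -RintegralD//; last by move: afw; under eq_fun do rewrite /= hornerZ -mulrA.
by apply: eq_Rintegral => x _; rewrite hornerD hornerZ mulrDl mulrA.
Qed.
End Moments.


HB.instance Definition _ (R : realType) (I : set R) (w : R -> R)
    (mI : measurable I) (hw : weight_on I w) :=
  GRing.isLinear.Build R {poly R} R _ (moment_functional mI hw)
    (moment_functional_linear mI hw).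

Section WeightedFunctional.
Variables (R : realType) (phi : {poly R}) (M : {scalar {poly R}}).

Definition weighted_functional (f : {poly R}) : R := M (phi * f).

Lemma weighted_functional_linear : scalar weighted_functional.
Proof.
by move=> a f g; rewrite /weighted_functional mulrDr -scalerAr linearP.
Qed.

HB.instance Definition _ :=
  GRing.isLinear.Build R {poly R} R _ weighted_functional weighted_functional_linear.
End WeightedFunctional.

(** * The coordinate ring of the curve *)

Section CurveRing.
Variables (R : realType) (phi : {poly R}).
Implicit Types (f g : curve_ring phi) (u v : {poly R}).

(** A quotient by a polynomial is formed with [mk_monic], which replaces a constant or
    non-monic modulus by 'X; hence these two facts are needed first. *)
Lemma size_monic_curve_poly :
  size (curve_poly phi) = 3%N /\ curve_poly phi \is monic.
Proof.
have sphi : (size (- phi%:P)%R < size ('X ^+ 2 : {poly {poly R}}))%N.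
  by rewrite size_polyN size_polyXn (leq_ltn_trans (size_polyC_leq1 _)).
by rewrite monicE lead_coefDl// lead_coefXn size_polyDl// size_polyXn.
Qed.

Lemma mk_monic_curve_poly : mk_monic (curve_poly phi) = curve_poly phi.
Proof. by rewrite /mk_monic; have [-> ->] := size_monic_curve_poly. Qed.

Lemma size_curve_ring f : (size (f : {poly {poly R}}) <= 2)%N.
Proof.
have s3 : size (mk_monic (curve_poly phi)) = 3%N.
  by rewrite mk_monic_curve_poly; have [] := size_monic_curve_poly.
by rewrite -ltnS -s3; exact: size_mk_monic.
Qed.

Lemma yvarE : yvar phi = 'X :> {poly {poly R}}.
Proof. by have [s m] := size_monic_curve_poly; rewrite [LHS]qpolyXE ?s. Qed.

Lemma of_xM u v : of_x phi (u * v) = of_x phi u * of_x phi v.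
Proof. by rewrite /of_x -scalerAl mul1r scalerA. Qed.

Lemma of_xD u v : of_x phi (u + v) = of_x phi u + of_x phi v.
Proof. by rewrite /of_x scalerDl. Qed.

Lemma mul_of_x u f : of_x phi u * f = u *: f.
Proof. by rewrite /of_x -scalerAl mul1r. Qed.

Lemma curve_ring_val u v :
  of_x phi u + yvar phi * of_x phi v = u%:P + v *: 'X :> {poly {poly R}}.
Proof.
rewrite [X in _ + X]mulrC mul_of_x poly_of_qpolyD /of_x !poly_of_qpolyZ yvarE.
by rewrite [polyn 1]/= alg_polyC.
Qed.

Lemma curve_ring_coef u v i :
  (of_x phi u + yvar phi * of_x phi v : {poly {poly R}})`_i
  = if i is 0 then u else if i is 1 then v else 0.
Proof.
rewrite curve_ring_val coefD coefC coefZ coefX.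
by case: i => [|[|i]]; rewrite /= ?mulr0 ?mulr1 ?add0r ?addr0.
Qed.

Lemma curve_ring_decomposition f :
  f = of_x phi (f : {poly {poly R}})`_0
      + yvar phi * of_x phi (f : {poly {poly R}})`_1.
Proof.
apply/val_inj/polyP => i /=; rewrite curve_ring_coef.
case: i => [|[|i]]//.
by rewrite nth_default// (leq_trans (size_curve_ring f)).
Qed.

Lemma yvar_sqr : yvar phi * yvar phi = of_x phi phi.
Proof.
have in0 : in_qpoly (curve_poly phi) (curve_poly phi) = 0.
  apply/val_inj; rewrite /= mk_monic_curve_poly Pdiv.RingMonic.rmodpp//.
  by have [] := size_monic_curve_poly.
rewrite /yvar -in_qpolyM -expr2 -[X in in_qpoly _ X](subrK phi%:P).
rewrite in_qpolyD [X in X + _]in0 add0r /of_x -in_qpoly1 -in_qpolyZ.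
by rewrite alg_polyC.
Qed.

Lemma curve_ring_mul u1 v1 u2 v2 :
  (of_x phi u1 + yvar phi * of_x phi v1) * (of_x phi u2 + yvar phi * of_x phi v2)
  = of_x phi (u1 * u2 + phi * (v1 * v2))
    + yvar phi * of_x phi (u1 * v2 + v1 * u2).
Proof.
rewrite !of_xD !of_xM -yvar_sqr.
by ring.
Qed.

Lemma curve_evalE u v x y :
  curve_eval (of_x phi u + yvar phi * of_x phi v) x y = u.[x] + v.[x] * y.
Proof.
by rewrite /curve_eval curve_ring_val !hornerE.
Qed.
End CurveRing.

(** * The inner product on the curve *)

(** The summand vanishes both below 1 and below lo, so the range may start at 1, whether lo
    is positive or not. *)
Lemma sumz_from1 (V : nmodType) (lo : int) (h : nat) (F : int -> V) :
  lo <= h%:Z -> (forall r : int, r <= 0 -> F r = 0) ->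
  (forall r : int, r < lo -> F r = 0) ->
  sumz lo h%:Z F = \sum_(i < h) F (i.+1)%:Z.
Proof.
move=> loh F0 Flo; rewrite /sumz loh -(big_mkord xpredT (fun i => F i.+1%:Z)).
have [lo0|lo1] := leP lo 0.
  have E : `|h%:Z - lo|%N = (`|lo| + h)%N by lia.
  rewrite E (big_cat_nat _ (n := `|lo|.+1)) //=; last by lia.
  rewrite big_nat_cond big1 ?add0r; last first.
    move=> i; rewrite andbT => /andP[_ ilo]; apply: F0; lia.
  rewrite -[in LHS](add0n `|lo|.+1) big_addn.
  have -> : ((`|lo| + h).+1 - `|lo|.+1 = h)%N by lia.
  by apply: eq_bigr => i _; congr F; lia.
rewrite [RHS](big_cat_nat _ (n := `|lo|.-1)) //=; last by lia.
rewrite [X in _ = X + _]big_nat_cond [X in _ = X + _]big1 ?add0r; last first.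
  by move=> i; rewrite andbT => /andP[_ ilo]; apply: Flo; lia.
rewrite -[in RHS](add0n `|lo|.-1) big_addn.
have -> : (`|h%:Z - lo|.+1 = h - `|lo|.-1)%N by lia.
by apply: eq_bigr => i _; congr F; lia.
Qed.

Section CurveInnerProduct.
Variables (R : realType) (I : set R) (w : R -> R) (phi : {poly R}).
Hypotheses (mI : measurable I) (hw : weight_on I w).
Hypothesis phi_gt0 : forall x, I x -> 0 < phi.[x].
Implicit Types f g h : curve_ring phi.

Let L : {scalar {poly R}} := moment_functional mI hw.
Let Lphi : {scalar {poly R}} := weighted_functional phi L.
Local Notation ip := (@curve_ip R I w phi).

Lemma poly_ip_moment (u v : {poly R}) : poly_ip I w u v = L (u * v).
Proof. by apply: eq_Rintegral => x _; rewrite hornerM. Qed.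

Lemma poly_ip_weighted (u v : {poly R}) :
  poly_ip I (times_weight phi w) u v = Lphi (u * v).
Proof.
apply: eq_Rintegral => x _; rewrite /times_weight !hornerM.
by rewrite mulrA [_ * phi.[x]]mulrC.
Qed.

(** Adding the values at the two points above x doubles the part of f * g that is even in y
    and cancels the odd part; the square of the root is phi since phi is positive on I. *)
Lemma curve_ip_moment f g :
  ip f g = 2 * L (f * g : {poly {poly R}})`_0.
Proof.
rewrite -[2 * _]linearZ.
rewrite (curve_ring_decomposition f) (curve_ring_decomposition g).
set u1 := (f : {poly {poly R}})`_0; set v1 := (f : {poly {poly R}})`_1.
set u2 := (g : {poly {poly R}})`_0; set v2 := (g : {poly {poly R}})`_1.
rewrite curve_ring_mul curve_ring_coef.
apply: eq_Rintegral => x; rewrite inE => /phi_gt0 phix.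
rewrite !curve_evalE; congr (_ * _).
rewrite !(hornerZ, hornerD, hornerM) -[in RHS](sqr_sqrtr (ltW phix)).
by ring.
Qed.

Lemma curve_ipC f g : ip f g = ip g f.
Proof. by rewrite !curve_ip_moment [f * g]mulrC. Qed.

Lemma curve_ipM v f g : ip (v * f) g = ip f (v * g).
Proof. by rewrite !curve_ip_moment [v * f]mulrC -mulrA. Qed.

Lemma curve_ip_linear (a : R) f g h :
  ip (a%:P *: f + g) h = a * ip f h + ip g h.
Proof.
rewrite !curve_ip_moment [(_ + g) * h]mulrDl -scalerAl poly_of_qpolyD poly_of_qpolyZ.
by rewrite coefD coefZ mul_polyC linearD linearZ /= mulrDr mulrCA.
Qed.

Lemma curve_ip0l g : ip 0 g = 0.
Proof. by rewrite curve_ip_moment mul0r coef0 linear0 mulr0. Qed.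

Lemma curve_ipZl a f h : ip (a%:P *: f) h = a * ip f h.
Proof. by have := curve_ip_linear a f 0 h; rewrite addr0 curve_ip0l addr0. Qed.

Lemma curve_ipDl f g h : ip (f + g) h = ip f h + ip g h.
Proof. by have := curve_ip_linear 1 f g h; rewrite scale1r mul1r. Qed.

Lemma curve_ipZr a f h : ip f (a%:P *: h) = a * ip f h.
Proof. by rewrite curve_ipC curve_ipZl curve_ipC. Qed.

Lemma curve_ip_suml (T : Type) (s : seq T) (F : T -> curve_ring phi) h :
  ip (\sum_(t <- s) F t) h = \sum_(t <- s) ip (F t) h.
Proof. by apply: (big_morph (ip^~ h) (fun f g => curve_ipDl f g h) (curve_ip0l h)). Qed.

(** Odd in y for true, even in y for false. *)
Definition y_parity (b : bool) f : Prop :=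
  (if b then (f : {poly {poly R}})`_0 else (f : {poly {poly R}})`_1) = 0.

Lemma y_parity_linear b (a : {poly R}) f g :
  y_parity b f -> y_parity b g -> y_parity b (a *: f + g).
Proof.
by rewrite /y_parity poly_of_qpolyD poly_of_qpolyZ; case: b;
  rewrite coefD coefZ => -> ->; rewrite mulr0 addr0.
Qed.

Lemma y_parity0 b : y_parity b 0.
Proof. by rewrite /y_parity; case: b; rewrite coef0. Qed.

Lemma y_parity_of_x u : y_parity false (of_x phi u).
Proof.
have := curve_ring_coef phi u 0 1.
by rewrite /of_x scale0r mulr0 addr0.
Qed.

Lemma y_parity_xvar b f : y_parity b f -> y_parity b (xvar phi * f).
Proof.
move=> fb; rewrite mul_of_x -[_ *: f]addr0.
by apply: y_parity_linear => //; exact: y_parity0.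
Qed.

Lemma y_parity_yvar b f : y_parity b f -> y_parity (~~ b) (yvar phi * f).
Proof.
have -> : yvar phi = of_x phi 0 + yvar phi * of_x phi 1.
  by rewrite /of_x scale0r add0r scale1r mulr1.
rewrite {2}(curve_ring_decomposition f) curve_ring_mul /y_parity !curve_ring_coef.
by case: b => /= ->; rewrite ?mul0r ?mul1r ?mulr0 ?addr0.
Qed.

(** The product of an even and an odd element is odd in y, so it has no even part. *)
Lemma curve_ip_parity b f g : y_parity b f -> y_parity (~~ b) g -> ip f g = 0.
Proof.
move=> fb gb; rewrite curve_ip_moment.
rewrite (curve_ring_decomposition f) (curve_ring_decomposition g).
rewrite curve_ring_mul curve_ring_coef.
by case: b fb gb => /= -> ->; rewrite ?(mul0r, mulr0) addr0 linear0 mulr0.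
Qed.

Variables (p q : nat -> {poly R}).
Hypothesis hp : orthonormal_polys I w p.
Hypothesis hq : orthonormal_polys I (times_weight phi w) q.

Lemma curve_ip_sqr u v :
  ip (of_x phi u + yvar phi * of_x phi v) (of_x phi u + yvar phi * of_x phi v)
  = 2 * (L (u * u) + Lphi (v * v)).
Proof.
by rewrite curve_ip_moment curve_ring_mul curve_ring_coef linearD.
Qed.

Lemma size_p n : size (p n) = n.+1. Proof. by have [/(_ n)[]] := hp. Qed.
Lemma size_q n : size (q n) = n.+1. Proof. by have [/(_ n)[]] := hq. Qed.

Lemma p_orthonormal m n : L (p m * p n) = (m == n)%:R.
Proof. by rewrite -poly_ip_moment; have [_] := hp. Qed.

Lemma q_orthonormal m n : Lphi (q m * q n) = (m == n)%:R.
Proof. by rewrite -poly_ip_weighted; have [_] := hq. Qed.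

Lemma curve_ip_ge0 f : 0 <= ip f f.
Proof.
rewrite (curve_ring_decomposition f) curve_ip_sqr mulr_ge0// addr_ge0//.
  exact: functional_sqr_ge0 size_p p_orthonormal _.
exact: functional_sqr_ge0 size_q q_orthonormal _.
Qed.

Lemma curve_ip_eq0 f : ip f f = 0 -> f = 0.
Proof.
rewrite (curve_ring_decomposition f) curve_ip_sqr.
set u := _`_0; set v := _`_1.
move/eqP; rewrite mulf_eq0 pnatr_eq0 /= paddr_eq0.
- move=> /andP[/eqP/(functional_sqr_eq0 size_p p_orthonormal) ->].
  move=> /eqP/(functional_sqr_eq0 size_q q_orthonormal) ->.
  by rewrite /of_x scale0r mulr0 addr0.
- exact: functional_sqr_ge0 size_p p_orthonormal _.
- exact: functional_sqr_ge0 size_q q_orthonormal _.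
Qed.

Lemma curve_ip_of_x_sum (T : Type) (s : seq T) (a : T -> R) (u : T -> {poly R})
    (c : R) f :
  ip f (of_x phi (c *: \sum_(t <- s) a t *: u t))
  = \sum_(t <- s) a t * ip f (of_x phi (c *: u t)).
Proof.
have -> : of_x phi (c *: \sum_(t <- s) a t *: u t)
    = \sum_(t <- s) (a t)%:P *: of_x phi (c *: u t).
  rewrite /of_x scaler_sumr scaler_suml; apply: eq_bigr => t _.
  by rewrite [in RHS]scalerA mul_polyC !scalerA [c * _]mulrC.
rewrite curve_ipC curve_ip_suml; apply: eq_bigr => t _.
by rewrite curve_ipZl curve_ipC.
Qed.

(** Since P1 q n = y * P0 q (n-1), pairings with the second half of the P-basis reduce to
    pairings with polynomials in x. *)
Lemma curve_ip_P1 f n : ip f (P1 phi q n) = ip (yvar phi * f) (P0 phi q n.-1).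
Proof. by rewrite curve_ipM. Qed.

(** For j = 0 the term with index j.-1 is harmless: its factor is beta (-1) = 0. *)
Lemma xvar_three_term (om : R -> R) (M : {scalar {poly R}}) (s : nat -> {poly R}) :
  (forall u v, poly_ip I om u v = M (u * v)) ->
  (forall n, size (s n) = n.+1) ->
  (forall m n, M (s m * s n) = (m == n)%:R) ->
  forall f (j : nat), ip (xvar phi * f) (P0 phi s j)
    = beta I om s (j%:Z - 1) * ip f (P0 phi s j.-1)
      + alpha I om s j * ip f (P0 phi s j)
      + beta I om s j * ip f (P0 phi s j.+1).
Proof.
move=> Mip size_s Mss f j.
have -> : ip (xvar phi * f) (P0 phi s j)
    = ip f (of_x phi ((Num.sqrt 2)^-1 *: ('X * s j))).
  by rewrite curve_ipM /P0 -of_xM -scalerAr.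
pose a (i : 'I_3) := nth 0 [:: beta I om s (j%:Z - 1); alpha I om s j; beta I om s j] i.
pose u (i : 'I_3) : {poly R} := nth 0 [:: s j.-1; s j; s j.+1] i.
have -> : 'X * s j = \sum_(i < 3) a i *: u i.
  rewrite (mulX_expansion size_s Mss) !big_ord_recl big_ord0 /a /u /= addr0 addrA.
  rewrite /alpha !Mip; congr (_ + _ + _).
  case: (j) => [|k]; first by rewrite scale0r.
  have -> : k.+1%:Z - 1 = k%:Z by lia.
  by rewrite /= Mip.
by rewrite (curve_ip_of_x_sum _ a u) !big_ord_recl big_ord0 /= addr0 addrA.
Qed.

Lemma curve_ip_xvar_P0 f (j : nat) :
  ip (xvar phi * f) (P0 phi p j)
  = beta I w p (j%:Z - 1) * ip f (P0 phi p j.-1)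
    + alpha I w p j * ip f (P0 phi p j)
    + beta I w p j * ip f (P0 phi p j.+1).
Proof. exact: (xvar_three_term poly_ip_moment size_p p_orthonormal). Qed.

Lemma curve_ip_xvar_P1 f (j : nat) :
  ip (xvar phi * f) (P1 phi q j.+1)
  = beta I (times_weight phi w) q (j%:Z - 1) * ip f (P1 phi q j)
    + alpha I (times_weight phi w) q j * ip f (P1 phi q j.+1)
    + beta I (times_weight phi w) q j * ip f (P1 phi q j.+2).
Proof.
rewrite !curve_ip_P1 mulrCA.
by rewrite (xvar_three_term poly_ip_weighted size_q q_orthonormal).
Qed.

Variable d : nat.
Hypothesis size_phi : size phi = d.+1.

Lemma size_phiM n (u : {poly R}) : size u = n.+1 -> size (phi * u) = (d + n).+1.
Proof.
move=> su; rewrite size_mul -?size_poly_eq0 ?size_phi ?su//.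
by rewrite addSn addnS.
Qed.

(** The polynomial p j is expanded in the q i.  As the pairing for phi w of p j and q i is
    the pairing for w of p j and phi * q i, of degree d + i, only j - d <= i <= j
    contribute. *)
Lemma curve_ip_yvar_P0 f (j : nat) (D : int -> R) :
  (forall i : nat, D i.+1%:Z = ip f (P1 phi q i.+1)) ->
  ip (yvar phi * f) (P0 phi p j)
  = sumz (j%:Z - d%:Z + 1) (j%:Z + 1)
      (fun r => rcoef I w phi p q (r - 1) j * D r).
Proof.
move=> DE; have -> : j%:Z + 1 = j.+1%:Z by lia.
rewrite sumz_from1; first last.
- move=> r rlo; case E : (r - 1) => [i|i]; rewrite ?mul0r//=.
  rewrite poly_ip_weighted /Lphi /= /weighted_functional mulrCA.
  rewrite mulrC.
  rewrite [p j * _]mulrC.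
  rewrite (orthonormal_low_degree size_p p_orthonormal) ?mulr0//.
  by rewrite (size_phiM (size_q i)); lia.
- by move=> r r0; case E : (r - 1) => [i|i]; rewrite ?mul0r//; lia.
- by lia.
rewrite /P0 {1}(orthonormal_expansion size_q q_orthonormal (eq_leq (size_p j))).
rewrite curve_ip_of_x_sum; apply: eq_bigr => i _.
rewrite DE curve_ip_P1; congr (_ * _).
have -> : i.+1%:Z - 1 = i%:Z by lia.
by rewrite /= poly_ip_weighted.
Qed.

(** Multiplying by y twice gives phi, and phi * q j has degree d + j; its pairing for w with
    p r is the pairing for phi w of q j and p r, which vanishes for r < j. *)
Lemma curve_ip_yvar_P1 f (j : nat) (D : nat -> R) :
  (forall i : nat, D i = ip f (P0 phi p i)) ->
  ip (yvar phi * f) (P1 phi q j.+1)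
  = \sum_(j <= r < (j + d).+1) rcoef I w phi p q j%:Z r * D r.
Proof.
move=> DE.
have -> : ip (yvar phi * f) (P1 phi q j.+1)
    = ip f (of_x phi ((Num.sqrt 2)^-1 *: (phi * q j))).
  by rewrite curve_ip_P1 mulrA yvar_sqr curve_ipM /P0 -of_xM -scalerAr.
have sphiq : (size (phi * q j)%R <= (j + d).+1)%N.
  by rewrite (size_phiM (size_q j)) addnC.
rewrite {1}(orthonormal_expansion size_p p_orthonormal sphiq) curve_ip_of_x_sum.
have E r : L (phi * q j * p r) = rcoef I w phi p q j%:Z r.
  by rewrite /= poly_ip_weighted -mulrA [q j * _]mulrC.
under eq_bigr do rewrite E -[ip f _]/(ip f (P0 phi p _)) -DE.
rewrite -(big_mkord xpredT (fun r => rcoef I w phi p q j%:Z r * D r)).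
rewrite [LHS](big_cat_nat _ (n := j)) //=; last by lia.
rewrite big_nat_cond big1 ?add0r// => r; rewrite andbT => /andP[_ rj].
by rewrite poly_ip_weighted (orthonormal_low_degree size_q q_orthonormal) ?mul0r// size_p.
Qed.
End CurveInnerProduct.

(** * Spans and the order of construction *)

(** The index k - 1 has the wrong parity. *)
Lemma big_nat_same_parity (V : nmodType) (k : nat) (F : nat -> V) :
  \sum_(1 <= r < k | odd r == odd k) F r
  = \sum_(1 <= r < k - 1 | odd r == odd k) F r.
Proof.
case: k => [|[|k]]; [by rewrite !big_geq..|].
rewrite subn1 big_mkcond big_nat_recr //= -big_mkcond /=.
by case: (odd k); rewrite addr0.
Qed.

Section Spans.
Variables (R : realType) (phi : {poly R}).
Implicit Types (f g h : curve_ring phi) (s : seq (curve_ring phi)).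

Lemma in_span_closed (Q : curve_ring phi -> Prop) s f :
  Q 0 -> (forall (a : R) g h, Q g -> Q h -> Q (a%:P *: g + h)) ->
  (forall g, g \in s -> Q g) -> in_span s f -> Q f.
Proof.
move=> Q0 Qlin Qs [c ->].
elim/big_rec: _ => // i g _ Qg; apply: Qlin => //.
by apply: Qs; exact: mem_nth.
Qed.

Lemma in_span0 s : in_span s 0.
Proof. by exists (fun=> 0); rewrite big1// => i _; rewrite polyC0 scale0r. Qed.

Lemma in_span_linear s (a : R) f g :
  in_span s f -> in_span s g -> in_span s (a%:P *: f + g).
Proof.
move=> [c ->] [c' ->]; exists (fun i => a * c i + c' i).
rewrite scaler_sumr -big_split; apply: eq_bigr => i _ /=.
by rewrite polyCD polyCM scalerDl scalerA.
Qed.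

Lemma in_span_mem s f : f \in s -> in_span s f.
Proof.
move=> fs; have fi : (index f s < size s)%N by rewrite index_mem.
exists (fun i => (i == index f s)%:R).
rewrite (bigD1 (Ordinal fi)) //= eqxx scale1r nth_index// big1 ?addr0// => i.
by rewrite -val_eqE /= => /negPf ->; rewrite scale0r.
Qed.

Lemma in_span_sub s1 s2 f : {subset s1 <= s2} -> in_span s1 f -> in_span s2 f.
Proof.
move=> s12; apply: in_span_closed; first exact: in_span0.
  by move=> a g h; exact: in_span_linear.
by move=> g /s12; exact: in_span_mem.
Qed.

Lemma in_spanZ s (a : R) f : in_span s f -> in_span s (a%:P *: f).
Proof.
by move=> fs; rewrite -[_ *: f]addr0; apply: in_span_linear => //; exact: in_span0.
Qed.
End Spans.

Section PreviousIndices.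
Variables (T : eqType) (d : nat) (Y : nat -> nat -> T).

Definition valid_index (n k : nat) : bool := (1 <= k <= minn n.+1 d)%N.

Definition precedes (m i n k : nat) : bool :=
  (m < n)%N || (m == n) && (i < k)%N.

Lemma lexicographic_ind (Q : nat -> nat -> Prop) :
  (forall n k, valid_index n k ->
     (forall m i, valid_index m i -> precedes m i n k -> Q m i) -> Q n k) ->
  forall n k, valid_index n k -> Q n k.
Proof.
move=> IH; elim/ltn_ind => n IHn; elim/ltn_ind => k IHk nk.
apply: IH => // m i mi /orP[mn|/andP[/eqP mn ik]]; first exact: IHn.
by move: mi; rewrite mn => mi; exact: IHk.
Qed.

(** The bound on k allows one step past the end of level n, where the list contains all of
    level n. *)
Lemma previousP n k f : (k <= (minn n.+1 d).+1)%N ->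
  reflect (exists m i, [/\ valid_index m i, precedes m i n k & f = Y m i])
    (f \in previous d Y n k).
Proof.
move=> nk; apply: (iffP idP); rewrite mem_cat.
- case/orP => [/allpairsPdep[m [i [+ + ->]]]|/mapP[i + ->]].
    rewrite !mem_iota => mn iv; exists m, i; split => //.
    by case/andP: mn => _; rewrite /precedes add0n => ->.
  rewrite mem_iota add1n ltnS => /andP[i1 ik]; exists n, i; split => //.
    by rewrite /valid_index i1 (leq_trans ik)//; lia.
  by rewrite /precedes eqxx (leq_ltn_trans ik) ?orbT//; have := leq_trans i1 ik; lia.
- case=> m [i [mi mink ->]]; apply/orP; move: mink => /orP[mn|/andP[/eqP mn ik]].
    by left; apply/allpairsPdep; exists m, i; rewrite !mem_iota; split.
  right; rewrite mn; apply/mapP; exists i => //.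
  by rewrite mem_iota; move: mi; rewrite /valid_index; lia.
Qed.

Lemma previous_sub n k n' k' :
  (k <= (minn n.+1 d).+1)%N -> (k' <= (minn n'.+1 d).+1)%N ->
  (n < n')%N || (n == n') && (k <= k')%N ->
  {subset previous d Y n k <= previous d Y n' k'}.
Proof.
move=> nk nk' le f /(previousP _ nk)[m [i [mi mink fE]]].
apply/(previousP _ nk'); exists m, i; split => //.
by move: mink le; rewrite /precedes; lia.
Qed.

Lemma previous_rcons n k : (1 <= k)%N ->
  previous d Y n k.+1 = rcons (previous d Y n k) (Y n k).
Proof.
case: k => // k _; rewrite /previous -cats1 -catA; congr (_ ++ _).
by rewrite -[k.+2.-1](addn1 k) iotaD map_cat.
Qed.

Lemma previous_next_level n :
  previous d Y n.+1 1 = previous d Y n (minn n.+1 d).+1.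
Proof.
rewrite /previous -[X in iota 0 X]addn1 iotaD map_cat flatten_cat /=.
by rewrite !cats0.
Qed.

Lemma previous_ind (Q : seq T -> Prop) :
  Q [::] ->
  (forall n k, valid_index n k -> Q (previous d Y n k) ->
     Q (rcons (previous d Y n k) (Y n k))) ->
  forall n k, (1 <= k <= (minn n.+1 d).+1)%N -> Q (previous d Y n k).
Proof.
move=> Q0 QS; elim=> [|n IHn].
all: elim=> [//|[|k] IHk] nk.
- exact: Q0.
- by rewrite previous_rcons//; apply: QS; [|apply: IHk; lia]; rewrite /valid_index; lia.
- by rewrite previous_next_level; apply: IHn; lia.
- by rewrite previous_rcons//; apply: QS; [|apply: IHk; lia]; rewrite /valid_index; lia.
Qed.

Lemma sum_previous (V : nmodType) n k (G : T -> V) : (1 <= k)%N ->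
  \sum_(h <- previous d Y n k) G h
  = \sum_(m < n) \sum_(1 <= i < (minn m.+1 d).+1) G (Y m i)
    + \sum_(1 <= i < k) G (Y n i).
Proof.
move=> k1; rewrite /previous big_cat /= big_map; congr (_ + _).
  rewrite big_allpairs_dep -(big_mkord xpredT
    (fun m => \sum_(1 <= i < (minn m.+1 d).+1) G (Y m i))) /index_iota subn0.
  by apply: eq_bigr => m _; rewrite subn1.
by rewrite /index_iota subn1.
Qed.
End PreviousIndices.

(** * Orthogonalisation and parity *)

Section OrthogonalBasis.
Variables (R : realType) (I : set R) (w : R -> R) (phi : {poly R}).
Hypotheses (mI : measurable I) (hw : weight_on I w).
Hypothesis phi_gt0 : forall x, I x -> 0 < phi.[x].
Variables (p q : nat -> {poly R}).
Hypothesis hp : orthonormal_polys I w p.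
Hypothesis hq : orthonormal_polys I (times_weight phi w) q.
Implicit Types (f g h e : curve_ring phi) (s : seq (curve_ring phi)).
Local Notation ip := (@curve_ip R I w phi).
Let ipC := curve_ipC mI hw phi_gt0.
Let ipM := curve_ipM mI hw phi_gt0.
Let ip0l := curve_ip0l mI hw phi_gt0.
Let ipZl := curve_ipZl mI hw phi_gt0.
Let ipZr := curve_ipZr mI hw phi_gt0.
Let ipDl := curve_ipDl mI hw phi_gt0.
Let ip_suml := curve_ip_suml mI hw phi_gt0.
Let ip_parity := curve_ip_parity mI hw phi_gt0.

(** A degenerate orthogonalisation step yields 0, because the inverse of 0 is 0. *)
Definition unit_or_zero f : Prop := ip f f = 1 \/ f = 0.

Definition orthonormal_up_to_zeros s : Prop :=
  pairwise (fun f g => ip f g == 0) s /\ {in s, forall f, unit_or_zero f}.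

(** If the residue f - g is not zero, then f is its norm times e plus g; if it is zero, then
    f = g is already in the span of s. *)
Lemma orthogonalisesP s f e : orthogonalises I w s f e ->
  [/\ {in s, forall h, ip e h = 0}, unit_or_zero e & in_span (rcons s e) f].
Proof.
move=> [g [gs orth] eE].
have r_ge0 := curve_ip_ge0 mI hw phi_gt0 hp hq (f - g).
have [r0|r_gt0] := leP (ip (f - g) (f - g)) 0.
  have {}r0 : f - g = 0.
    by apply: (curve_ip_eq0 mI hw phi_gt0 hp hq); apply/le_anti; rewrite r0 r_ge0.
  have {}eE : e = 0 by rewrite eE r0 scaler0.
  split; [by move=> h _; rewrite eE ip0l|by right|].
  rewrite -(subrK g f) r0 add0r.
  by apply: in_span_sub gs => h; rewrite mem_rcons in_cons orbC => ->.
split.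
- by move=> h hs; rewrite eE ipZl (orth h (in_span_mem hs)) mulr0.
- left; rewrite eE ipZl ipZr mulrA -invfM -expr2 sqr_sqrtr// mulVf//.
  by rewrite gt_eqF.
- have -> : f = (Num.sqrt (ip (f - g) (f - g)))%:P *: e + g.
    rewrite eE scalerA -polyCM mulfV ?scale1r ?subrK//.
    by rewrite gt_eqF// sqrtr_gt0.
  apply: in_span_linear; first by apply: in_span_mem; rewrite mem_rcons mem_head.
  by apply: in_span_sub gs => h; rewrite mem_rcons in_cons orbC => ->.
Qed.

(** A zero member of s contributes nothing to either side, so only unit vectors matter. *)
Lemma fourier_expansion s f : orthonormal_up_to_zeros s -> in_span s f ->
  f = \sum_(h <- s) (ip f h)%:P *: h.
Proof.
move=> [/(pairwiseP 0) orth unit0] [c fE].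
rewrite (big_nth 0) big_mkord {1}fE; apply: eq_bigr => i _.
have -> : ip f s`_i = c i * ip s`_i s`_i.
  rewrite fE ip_suml (bigD1 i) //= ipZl big1 ?addr0// => j ji.
  have := ji; rewrite ipZl -val_eqE /= neq_ltn => /orP[lt|lt].
    by have /eqP -> := orth j i (ltn_ord j) (ltn_ord i) lt; rewrite mulr0.
  by have /eqP := orth i j (ltn_ord i) (ltn_ord j) lt; rewrite ipC => ->; rewrite mulr0.
have [->|->] := unit0 _ (mem_nth 0 (ltn_ord i)); first by rewrite mulr1.
by rewrite !scaler0.
Qed.

Variables (d : nat) (Y : nat -> nat -> curve_ring phi).
Hypothesis d_ge2 : (2 <= d)%N.
Hypothesis hY : Y_construction I w d p Y.

(** The element whose orthogonalisation is Y n k.  The starting value P0 p 0 fits in as the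
    orthogonalisation of itself, since it has norm 1. *)
Definition construction_source (n k : nat) : curve_ring phi :=
  if n isn't m.+1 then P0 phi p 0
  else if (m <= d - 2)%N then
    if (k <= m.+1)%N then xvar phi * Y m k else yvar phi * Y m m.+1
  else yvar phi * Y m k.

Lemma Y_orthogonalises n k : valid_index d n k ->
  orthogonalises I w (previous d Y n k) (construction_source n k) (Y n k).
Proof.
have [Y01 Yx Yy1 Yy2] := hY.
case: n => [|m]; rewrite /valid_index => nk.
  have -> : k = 1%N by lia.
  exists 0.
    split; first exact: in_span0.
    by move=> h [c ->]; rewrite /= big_ord0 ipC ip0l.
  have P00 : ip (P0 phi p 0) (P0 phi p 0) = 1.
    have := curve_ip_sqr mI hw phi_gt0 ((Num.sqrt 2)^-1 *: p 0) 0.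
    rewrite [of_x phi 0]scale0r mulr0 addr0 mulr0 linear0 addr0 => ->.
    rewrite -scalerAl -scalerAr scalerA linearZ /= p_orthonormal//.
    by rewrite eqxx mulr1 -invfM -expr2 sqr_sqrtr ?ler0n// divff// pnatr_eq0.
  by rewrite subr0 P00 sqrtr1 invr1 scale1r.
rewrite /construction_source; case: ifPn => md.
  case: ifPn => km; first by apply: Yx => //; lia.
  have -> : k = m.+2 by lia.
  exact: Yy1.
by apply: Yy2; lia.
Qed.

Lemma previous_orthonormal n k : (1 <= k <= (minn n.+1 d).+1)%N ->
  orthonormal_up_to_zeros (previous d Y n k).
Proof.
apply: (previous_ind (Q := orthonormal_up_to_zeros)); first by split.
move=> {}n {}k /Y_orthogonalises/orthogonalisesP[orth unit0 _] [pw units].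
split.
  rewrite pairwise_rcons pw andbT; apply/allP => h hs.
  by rewrite ipC orth.
by move=> h; rewrite mem_rcons in_cons => /predU1P[->//|]; exact: units.
Qed.

Lemma construction_source_span n k : valid_index d n k ->
  in_span (previous d Y n k.+1) (construction_source n k).
Proof.
move=> nk; have [_ _] := orthogonalisesP (Y_orthogonalises nk).
by rewrite previous_rcons//; case/andP: nk.
Qed.

Lemma Y_orthogonal_span n k f : valid_index d n k ->
  in_span (previous d Y n k) f -> ip (Y n k) f = 0.
Proof.
move=> nk; have [orth _ _] := orthogonalisesP (Y_orthogonalises nk).
apply: (in_span_closed (Q := fun f => ip (Y n k) f = 0)); last exact: orth.
  by rewrite ipC ip0l.
by move=> a g h g0 h0; rewrite ipC ipDl ipZl ![ip _ (Y n k)]ipC g0 h0 mulr0 addr0.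
Qed.

(** On the levels n < d the truncated difference is 0 and Y n k is odd in y exactly when k is
    even; from level d on, multiplication by y flips the parity at each level. *)
Definition Y_parity (n k : nat) : bool := odd k.+1 (+) odd (n.+1 - d).

(** The source of Y n k has the right parity by induction.  Its projection on the previous
    elements only involves those of the same parity, as the others are orthogonal to it. *)
Lemma Y_y_parity n k : valid_index d n k -> y_parity (Y_parity n k) (Y n k).
Proof.
move: n k; apply: (lexicographic_ind (Q := fun n k => y_parity (Y_parity n k) (Y n k))).
move=> n k nk IH.
have src : y_parity (Y_parity n k) (construction_source n k).
  case: n => [|m] in nk IH *.
    have -> : Y_parity 0 k = false.
      move: nk; rewrite /Y_parity /valid_index => nk.
      have -> : k = 1%N by lia.
      by have -> : (1 - d = 0)%N by lia.
    exact: y_parity_of_x.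
  rewrite /construction_source; move: nk; rewrite /valid_index => nk; case: ifPn => md.
    have e1 : (m.+1 - d = 0)%N by lia.
    have e2 : (m.+2 - d = 0)%N by lia.
    case: ifPn => km.
      have -> : Y_parity m.+1 k = Y_parity m k by rewrite /Y_parity e1 e2.
      apply: y_parity_xvar; apply: IH; rewrite /valid_index /precedes; lia.
    have -> : Y_parity m.+1 k = ~~ Y_parity m m.+1.
      rewrite /Y_parity e1 e2 !addbF.
      by have -> : k = m.+2 by lia.
    apply: y_parity_yvar; apply: IH; rewrite /valid_index /precedes; lia.
  have -> : Y_parity m.+1 k = ~~ Y_parity m k.
    by rewrite /Y_parity subSn ?addbN//; lia.
  apply: y_parity_yvar; apply: IH; rewrite /valid_index /precedes; lia.
have [g [gs orth] ->] := Y_orthogonalises nk.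
rewrite -[_ *: _]addr0; apply: y_parity_linear; last exact: y_parity0.
rewrite addrC -scaleN1r; apply: y_parity_linear => //.
have fam : orthonormal_up_to_zeros (previous d Y n k).
  by apply: previous_orthonormal; move: nk; rewrite /valid_index; lia.
rewrite (fourier_expansion fam gs) big_seq.
elim/big_rec: _ => [|h g' hs g'_par]; first exact: y_parity0.
have nk' : (k <= (minn n.+1 d).+1)%N by move: nk; rewrite /valid_index; lia.
have gf : ip g h = ip (construction_source n k) h.
  have := orth h (in_span_mem hs).
  rewrite -scaleN1r addrC -polyC1 -polyCN (curve_ip_linear mI hw phi_gt0) mulN1r => /eqP.
  by rewrite addrC subr_eq0 => /eqP.
have /(previousP _ _ nk')[m [i [mi mink hE]]] := hs.
have hpar : y_parity (Y_parity m i) h by rewrite hE; exact: IH.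
have [par_eq|par_neq] := eqVneq (Y_parity m i) (Y_parity n k).
  by apply: y_parity_linear => //; rewrite -par_eq.
rewrite gf (ip_parity src) ?scale0r ?add0r//.
by move: hpar par_neq; case: (Y_parity m i); case: (Y_parity n k).
Qed.

Lemma mul_in_span s t v f :
  {in s, forall h, in_span t (v * h)} -> in_span s f -> in_span t (v * f).
Proof.
move=> vs; apply: (in_span_closed (Q := fun f => in_span t (v * f))) => //.
  by rewrite mulr0; exact: in_span0.
move=> a g h vg vh; rewrite mulrDr -scalerAr.
exact: in_span_linear.
Qed.

Lemma previous_mono n k n' k' f :
  (k <= (minn n.+1 d).+1)%N -> (k' <= (minn n'.+1 d).+1)%N ->
  (n < n')%N || (n == n') && (k <= k')%N ->
  in_span (previous d Y n k) f -> in_span (previous d Y n' k') f.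
Proof. by move=> nk nk' le; apply: in_span_sub; exact: previous_sub. Qed.

Lemma xvar_Y_in_span n k : (n <= d - 2)%N -> valid_index d n k ->
  in_span (previous d Y n.+1 k.+1) (xvar phi * Y n k).
Proof.
rewrite /valid_index => nd nk.
have := @construction_source_span n.+1 k; rewrite /construction_source nd.
have kn : (k <= n.+1)%N by lia.
by rewrite kn; apply; rewrite /valid_index; lia.
Qed.

Lemma yvar_Y_in_span_high n k : (d - 2 < n)%N -> valid_index d n k ->
  in_span (previous d Y n.+1 k.+1) (yvar phi * Y n k).
Proof.
rewrite /valid_index => nd nk.
have := @construction_source_span n.+1 k; rewrite /construction_source leqNgt nd.
by apply; rewrite /valid_index; lia.
Qed.

(** Up to multiples of earlier elements Y n k is x * Y (n-1) k when k <= n, so y * Y n k is x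
    times y * Y (n-1) k; by induction the latter is in the span of the elements up to
    Y n (k+1), which multiplication by x sends to the span of those up to Y (n+1) (k+1). *)
Lemma yvar_Y_in_span_low n k : (n <= d - 2)%N -> valid_index d n k ->
  in_span (previous d Y n.+1 k.+2) (yvar phi * Y n k).
Proof.
move=> + nk; move: n k nk; apply: (lexicographic_ind
  (Q := fun n k => (n <= d - 2)%N -> in_span (previous d Y n.+1 k.+2) (yvar phi * Y n k))).
move=> n k nk IH nd; have nk' := nk; rewrite /valid_index in nk'.
have [kn|kn] := leqP k n; last first.
  have -> : k = n.+1 by lia.
  have := @construction_source_span n.+1 n.+2; rewrite /construction_source nd ltnn.
  by apply; rewrite /valid_index; lia.
case: n => [|m] in nk nk' IH nd kn *; first by lia.
have [g [gs _] ->] := Y_orthogonalises nk.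
rewrite /construction_source.
have -> : (m <= d - 2)%N by lia.
rewrite kn -scalerAr; apply: in_spanZ; rewrite mulrBr.
rewrite addrC -scaleN1r -polyC1 -polyCN; apply: in_span_linear.
  apply: mul_in_span gs => h /(previousP _ _ _)[|i [l [il prec ->]]]; first by lia.
  move: (il) prec; rewrite /valid_index /precedes => il' prec.
  apply: (@previous_mono i.+1 l.+2); try lia.
  by apply: IH => //; lia.
rewrite mulrCA.
have yYm : in_span (previous d Y m.+1 k.+2) (yvar phi * Y m k).
  by apply: IH; rewrite /valid_index /precedes; lia.
apply: mul_in_span yYm => h /(previousP _ _ _)[|i [l [il prec ->]]]; first by lia.
move: (il) prec; rewrite /valid_index /precedes => il' prec.
apply: (@previous_mono i.+1 l.+1); try lia.
by apply: xvar_Y_in_span => //; lia.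
Qed.

(** Level n - 1 may start at any lo such that v sends the lower levels and the part of level
    n - 1 before lo into the span of the elements that precede Y n k.  For n = 0 the sum over
    level n - 1 is empty because minn n d = 0. *)
Lemma Y_recurrence v n k K lo b P (D : nat -> nat -> R) :
  valid_index d n k -> valid_index d n.+1 K ->
  in_span (previous d Y n.+1 K.+1) (v * Y n k) ->
  (0 < lo)%N ->
  (forall m i, valid_index d m i ->
     (m.+1 < n)%N || (m.+1 == n) && (i < lo)%N ->
     in_span (previous d Y n k) (v * Y m i)) ->
  y_parity b P ->
  (forall m i, valid_index d m i -> D m i = ip (Y m i) P) ->
  bcoef I w Y v n K k * D n.+1 K = ip (v * Y n k) P
    - \sum_(lo <= r < (minn n d).+1 | Y_parity (n - 1) r == b)
        bcoef I w Y v (n - 1) k r * D (n - 1)%N r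
    - \sum_(1 <= r < (minn n.+1 d).+1 | Y_parity n r == b)
        acoef I w Y v n r k * D n r
    - \sum_(1 <= r < K | Y_parity n.+1 r == b)
        bcoef I w Y v n r k * D n.+1 r.
Proof.
move=> nk nK span lo_gt0 low P_par DE.
have nk' := nk; have nK' := nK; rewrite /valid_index in nk' nK'.
have D0 m i : valid_index d m i -> Y_parity m i != b -> D m i = 0.
  move=> mi par; rewrite DE// (ip_parity (Y_y_parity mi))//.
  by move: P_par par; case: b; case: (Y_parity m i).
have filter m a c (F : nat -> R) : (0 < a)%N -> (c <= (minn m.+1 d).+1)%N ->
    \sum_(a <= r < c | Y_parity m r == b) F r * D m r
    = \sum_(a <= r < c) F r * D m r.
  move=> a0 cm; rewrite big_mkcond; apply: eq_big_nat => r rac.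
  by case: eqVneq => // par; rewrite D0 ?mulr0// /valid_index; lia.
rewrite !filter; try lia.
have fam : orthonormal_up_to_zeros (previous d Y n.+1 K.+1).
  by apply: previous_orthonormal; lia.
have -> : ip (v * Y n k) P
    = \sum_(h <- previous d Y n.+1 K.+1) ip (v * Y n k) h * ip h P.
  rewrite {1}(fourier_expansion fam span) ip_suml.
  by apply: eq_bigr => h _; rewrite ipZl.
rewrite sum_previous// big_nat_recr/=; last by lia.
rewrite big_ord_recr /=.
have -> : \sum_(1 <= i < (minn n.+1 d).+1) ip (v * Y n k) (Y n i) * ip (Y n i) P
    = \sum_(1 <= i < (minn n.+1 d).+1) acoef I w Y v n i k * D n i.
  by apply: eq_big_nat => i ni; rewrite /acoef ipC DE// /valid_index; lia.
have -> : \sum_(1 <= i < K) ip (v * Y n k) (Y n.+1 i) * ip (Y n.+1 i) P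
    = \sum_(1 <= i < K) bcoef I w Y v n i k * D n.+1 i.
  by apply: eq_big_nat => i ni; rewrite /bcoef ipC DE// /valid_index; lia.
have -> : ip (v * Y n k) (Y n.+1 K) * ip (Y n.+1 K) P
    = bcoef I w Y v n K k * D n.+1 K by rewrite /bcoef ipC DE.
suff -> : \sum_(m < n) \sum_(1 <= i < (minn m.+1 d).+1)
      ip (v * Y n k) (Y m i) * ip (Y m i) P
    = \sum_(lo <= r < (minn n d).+1) bcoef I w Y v (n - 1) k r * D (n - 1)%N r.
  by ring.
have vanish m i : valid_index d m i ->
    (m.+1 < n)%N || (m.+1 == n) && (i < lo)%N -> ip (v * Y n k) (Y m i) = 0.
  by move=> mi lt; rewrite ipM Y_orthogonal_span//; exact: low.
case: n => [|n] in nk nK span low fam nk' nK' vanish *.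
  by rewrite big_ord0 big_geq//; lia.
rewrite big_ord_recr /= big1 ?add0r => [|m _]; last first.
  rewrite big_nat_cond big1// => i; rewrite andbT => ni.
  have mi : valid_index d m i by rewrite /valid_index; lia.
  have mn := ltn_ord m.
  by rewrite vanish ?mul0r//; lia.
have [lo_le|lo_gt] := leqP lo (minn n.+1 d).+1; last first.
  rewrite [RHS]big_geq; last by lia.
  rewrite big_nat_cond big1// => i; rewrite andbT => ni.
  have mi : valid_index d n i by rewrite /valid_index; lia.
  by rewrite vanish ?mul0r//; lia.
rewrite (big_cat_nat _ (n := lo)) //= big_nat_cond big1 ?add0r; last first.
  move=> i; rewrite andbT => ni.
  have mi : valid_index d n i by rewrite /valid_index; lia.
  by rewrite vanish ?mul0r//; lia.
rewrite subn1 /=; apply: eq_big_nat => i ni.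
by rewrite ipM /bcoef DE// /valid_index; lia.
Qed.

Lemma Y_parity_eq n r b :
  (Y_parity n r == b) = (odd r == b (+) ~~ odd (n.+1 - d)).
Proof. by rewrite /Y_parity /=; case: (odd r); case: (odd (_ - _)); case: b. Qed.

Lemma x_recurrence n k b P (D : nat -> nat -> R) :
  (n <= d - 2)%N -> (1 <= k <= n.+1)%N -> odd k = ~~ b -> y_parity b P ->
  (forall m i, valid_index d m i -> D m i = ip (Y m i) P) ->
  bcoef I w Y (xvar phi) n k k * D n.+1 k = ip (xvar phi * Y n k) P
    - \sum_(k <= r < n.+1 | odd r == odd k)
        bcoef I w Y (xvar phi) (n - 1) k r * D (n - 1)%N r
    - \sum_(1 <= r < n.+2 | odd r == odd k)
        acoef I w Y (xvar phi) n r k * D n r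
    - \sum_(1 <= r < k - 1 | odd r == odd k)
        bcoef I w Y (xvar phi) n r k * D n.+1 r.
Proof.
move=> nd nk kb P_par DE.
have par m r : (m < d)%N -> (Y_parity m r == b) = (odd r == odd k).
  move=> md; rewrite Y_parity_eq kb; have -> : (m.+1 - d = 0)%N by lia.
  by rewrite addbT.
rewrite -big_nat_same_parity.
rewrite (@Y_recurrence _ n k k k b P D)//.
- have -> : minn n d = n by lia.
  have -> : minn n.+1 d = n.+1 by lia.
  by congr (_ - _ - _ - _); apply: eq_bigl => r; apply: par; lia.
- by rewrite /valid_index; lia.
- by rewrite /valid_index; lia.
- by apply: xvar_Y_in_span => //; rewrite /valid_index; lia.
- by lia.
- move=> m i mi lt; move: (mi); rewrite /valid_index => mi'.
  apply: (@previous_mono m.+1 i.+1); try lia.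
  by apply: xvar_Y_in_span => //; lia.
Qed.

(** On the low levels multiplication by y raises k by one, on the high levels it keeps k;
    hence the two bounds on lo. *)
Lemma yvar_Y_in_previous n k lo : valid_index d n k ->
  (if (n <= d - 1)%N then lo <= maxn (k - 1) 1 else lo <= k)%N ->
  forall m i, valid_index d m i ->
     (m.+1 < n)%N || (m.+1 == n) && (i < lo)%N ->
     in_span (previous d Y n k) (yvar phi * Y m i).
Proof.
rewrite /valid_index => nk lo_le m i mi lt.
have [md|md] := leqP m (d - 2).
  apply: (@previous_mono m.+1 i.+2); try by move: lo_le lt; case: ifP; lia.
  exact: yvar_Y_in_span_low.
apply: (@previous_mono m.+1 i.+1); try by move: lo_le lt; case: ifP; lia.
exact: yvar_Y_in_span_high.
Qed.

Lemma y_recurrence n k K lo b c1 c2 P (D : nat -> nat -> R) :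
  valid_index d n k -> valid_index d n.+1 K ->
  in_span (previous d Y n.+1 K.+1) (yvar phi * Y n k) ->
  (0 < lo)%N ->
  (if (n <= d - 1)%N then lo <= maxn (k - 1) 1 else lo <= k)%N ->
  c1 = b (+) ~~ odd ((n - 1).+1 - d) -> c2 = b (+) ~~ odd (n.+1 - d) ->
  odd K = b (+) ~~ odd (n.+2 - d) ->
  y_parity b P ->
  (forall m i, valid_index d m i -> D m i = ip (Y m i) P) ->
  bcoef I w Y (yvar phi) n K k * D n.+1 K = ip (yvar phi * Y n k) P
    - \sum_(lo <= r < (minn n d).+1 | odd r == c1)
        bcoef I w Y (yvar phi) (n - 1) k r * D (n - 1)%N r
    - \sum_(1 <= r < (minn n.+1 d).+1 | odd r == c2)
        acoef I w Y (yvar phi) n r k * D n r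
    - \sum_(1 <= r < K - 1 | odd r == odd K)
        bcoef I w Y (yvar phi) n r k * D n.+1 r.
Proof.
move=> nk nK span lo0 lo_le c1E c2E KE P_par DE.
rewrite (Y_recurrence nk nK span lo0 (yvar_Y_in_previous nk lo_le) P_par DE).
rewrite -big_nat_same_parity.
by congr (_ - _ - _ - _); apply: eq_bigl => r; rewrite Y_parity_eq ?c1E ?c2E ?KE.
Qed.
End OrthogonalBasis.

(** * The connection coefficients *)

Section ConnectionCoefficients.
Variables (R : realType) (I : set R) (w : R -> R) (phi : {poly R}) (d : nat).
Variables (p q : nat -> {poly R}) (Y : nat -> nat -> curve_ring phi).
Variable C : int -> nat -> R.
Hypothesis hC : connection_coeffs I w d p q Y C.
Local Notation ip := (@curve_ip R I w phi).

(** For j = 0 the index 2 * j - 1 is the conventional row -1. *)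
Lemma connection_coeff_P0 (j n k : nat) : valid_index d n k ->
  C (2 * j%:Z - 1) (ell d n k) = ip (Y n k) (P0 phi p j).
Proof.
move=> nk; have [hC0 hCm1] := hC; have [C0 Ci] := hC0 n k nk.
case: j => [|j]; last by have [] := Ci j.+1 isT.
by rewrite -C0 -hCm1.
Qed.

Lemma connection_coeff_P1 (j n k : nat) : valid_index d n k ->
  C (2 * j.+1%:Z) (ell d n k) = ip (Y n k) (P1 phi q j.+1).
Proof.
by move=> nk; have [hC0 _] := hC; have [_ /(_ j.+1 isT)[]] := hC0 n k nk.
Qed.
End ConnectionCoefficients.

(* The sums over level n - 1 are empty when n = 0, so the truncation of
   (n - 1)%N is harmless there. *)
Theorem propositionA1 (R : realType) (I : set R) (w : R -> R) (phi : {poly R})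
    (d : nat) (p q : nat -> {poly R}) (Y : nat -> nat -> curve_ring phi)
    (C : int -> nat -> R)
    (hI : weight_interval I) (hw : weight_on I w)
    (hd : (4 <= d)%N) (hphi_deg : size phi = d.+1)
    (hphi_pos : forall x, I x -> 0 < phi.[x])
    (hp : orthonormal_polys I w p)
    (hq : orthonormal_polys I (times_weight phi w) q)
    (hY : Y_construction I w d p Y)
    (hC : connection_coeffs I w d p q Y C) :
  let alpha_w := alpha I w p in
  let beta_w := beta I w p in
  let alpha_phiw := alpha I (times_weight phi w) q in
  let beta_phiw := beta I (times_weight phi w) q in
  let rr := rcoef I w phi p q in
  let ax := acoef I w Y (xvar phi) in
  let bx := bcoef I w Y (xvar phi) in
  let ay := acoef I w Y (yvar phi) in
  let by_ := bcoef I w Y (yvar phi) in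
  let l := ell d in
  forall j : nat, (1 <= j)%N ->
  [/\ (forall n : nat, (n <= d - 2)%N ->
       (forall k : nat, odd k -> (1 <= k <= n.+1)%N ->
          bx n k k * C (2 * j%:Z - 1) (l n.+1 k)
          = beta_w (j%:Z - 1) * C (2 * j%:Z - 3) (l n k)
            + alpha_w j * C (2 * j%:Z - 1) (l n k)
            + beta_w j%:Z * C (2 * j%:Z + 1) (l n k)
            - \sum_(k <= r < n.+1 | odd r == odd k) bx (n - 1)%N k r * C (2 * j%:Z - 1) (l (n - 1)%N r)
            - \sum_(1 <= r < n.+2 | odd r == odd k) ax n r k * C (2 * j%:Z - 1) (l n r)
            - \sum_(1 <= r < k - 1 | odd r == odd k) bx n r k * C (2 * j%:Z - 1) (l n.+1 r))
       /\ (forall k : nat, ~~ odd k -> (2 <= k <= n.+1)%N ->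
          bx n k k * C (2 * j%:Z) (l n.+1 k)
          = beta_phiw (j%:Z - 2) * C (2 * j%:Z - 2) (l n k)
            + alpha_phiw (j - 1)%N * C (2 * j%:Z) (l n k)
            + beta_phiw (j%:Z - 1) * C (2 * j%:Z + 2) (l n k)
            - \sum_(k <= r < n.+1 | odd r == odd k) bx (n - 1)%N k r * C (2 * j%:Z) (l (n - 1)%N r)
            - \sum_(1 <= r < n.+2 | odd r == odd k) ax n r k * C (2 * j%:Z) (l n r)
            - \sum_(1 <= r < k - 1 | odd r == odd k) bx n r k * C (2 * j%:Z) (l n.+1 r))),

      (forall n k : nat, (n <= d - 2)%N -> k = n.+1 ->
       (odd n ->
          by_ n k.+1 k * C (2 * j%:Z - 1) (l n.+1 k.+1)
          = sumz (j%:Z - d%:Z + 1) (j%:Z + 1)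
                (fun r => rr (r - 1) j * C (2 * r) (l n k))
            - \sum_(maxn (k - 1) 1 <= r < n.+1 | odd r == odd (k - 1)) by_ (n - 1)%N k r * C (2 * j%:Z - 1) (l (n - 1)%N r)
            - \sum_(1 <= r < n.+2 | odd r == odd (k - 1)) ay n r k * C (2 * j%:Z - 1) (l n r)
            - \sum_(1 <= r < k | odd r == odd (k - 1)) by_ n r k * C (2 * j%:Z - 1) (l n.+1 r))
       /\ (~~ odd n ->
          by_ n k.+1 k * C (2 * j%:Z) (l n.+1 k.+1)
          = \sum_(j - 1 <= r < (j - 1 + d).+1)
                rr (j%:Z - 1) r * C (2 * r%:Z - 1) (l n k)
            - \sum_(maxn (k - 1) 1 <= r < n.+1 | odd r == odd (k - 1)) by_ (n - 1)%N k r * C (2 * j%:Z) (l (n - 1)%N r)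
            - \sum_(1 <= r < n.+2 | odd r == odd (k - 1)) ay n r k * C (2 * j%:Z) (l n r)
            - \sum_(1 <= r < k | odd r == odd (k - 1)) by_ n r k * C (2 * j%:Z) (l n.+1 r))),

      (forall n : nat, n = (d - 1)%N ->
       (forall k : nat, ~~ odd k -> (2 <= k <= d)%N ->
          by_ n k k * C (2 * j%:Z - 1) (l n.+1 k)
          = sumz (j%:Z - d%:Z + 1) (j%:Z + 1)
                (fun r => rr (r - 1) j * C (2 * r) (l n k))
            - \sum_(maxn (k - 1) 1 <= r < d | odd r == odd (k - 1)) by_ (n - 1)%N k r * C (2 * j%:Z - 1) (l (n - 1)%N r)
            - \sum_(1 <= r < d.+1 | odd r == odd (k - 1)) ay n r k * C (2 * j%:Z - 1) (l n r)
            - \sum_(1 <= r < k - 1 | odd r == odd k) by_ n r k * C (2 * j%:Z - 1) (l n.+1 r))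
       /\ (forall k : nat, odd k -> (1 <= k <= d)%N ->
          by_ n k k * C (2 * j%:Z) (l n.+1 k)
          = \sum_(j - 1 <= r < (j - 1 + d).+1)
                rr (j%:Z - 1) r * C (2 * r%:Z - 1) (l n k)
            - \sum_(maxn (k - 1) 1 <= r < d | odd r == odd (k - 1)) by_ (n - 1)%N k r * C (2 * j%:Z) (l (n - 1)%N r)
            - \sum_(1 <= r < d.+1 | odd r == odd (k - 1)) ay n r k * C (2 * j%:Z) (l n r)
            - \sum_(1 <= r < k - 1 | odd r == odd k) by_ n r k * C (2 * j%:Z) (l n.+1 r)))

    & (forall n k : nat, (d <= n)%N -> (1 <= k <= d)%N ->
       (odd (n + 1 - d) /\ odd k \/ ~~ odd (n + 1 - d) /\ ~~ odd k ->
          by_ n k k * C (2 * j%:Z - 1) (l n.+1 k)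
          = sumz (j%:Z - d%:Z + 1) (j%:Z + 1)
                (fun r => rr (r - 1) j * C (2 * r) (l n k))
            - \sum_(k <= r < d.+1 | odd r == odd k) by_ (n - 1)%N k r * C (2 * j%:Z - 1) (l (n - 1)%N r)
            - \sum_(1 <= r < d.+1 | odd r == odd (k - 1)) ay n r k * C (2 * j%:Z - 1) (l n r)
            - \sum_(1 <= r < k - 1 | odd r == odd k) by_ n r k * C (2 * j%:Z - 1) (l n.+1 r))
       /\ (~~ odd (n + 1 - d) /\ odd k \/ odd (n + 1 - d) /\ ~~ odd k ->
          by_ n k k * C (2 * j%:Z) (l n.+1 k)
          = \sum_(j - 1 <= r < (j - 1 + d).+1)
                rr (j%:Z - 1) r * C (2 * r%:Z - 1) (l n k)
            - \sum_(k <= r < d.+1 | odd r == odd k) by_ (n - 1)%N k r * C (2 * j%:Z) (l (n - 1)%N r)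
            - \sum_(1 <= r < d.+1 | odd r == odd (k - 1)) ay n r k * C (2 * j%:Z) (l n r)
            - \sum_(1 <= r < k - 1 | odd r == odd k) by_ n r k * C (2 * j%:Z) (l n.+1 r)))].
Proof.
have mI := weight_interval_measurable hI.
have d2 : (2 <= d)%N by lia.
move=> alpha_w beta_w alpha_phiw beta_phiw rr ax bx ay by_ l [//|j] _.
pose DX (n k : nat) := C (2 * j.+1%:Z - 1) (l n k).
pose DY (n k : nat) := C (2 * j.+1%:Z) (l n k).
have DXE m i : valid_index d m i -> DX m i = curve_ip I w (Y m i) (P0 phi p j.+1).
  exact: (connection_coeff_P0 hC).
have DYE m i : valid_index d m i -> DY m i = curve_ip I w (Y m i) (P1 phi q j.+1).
  exact: (connection_coeff_P1 hC).
have P0_par : y_parity false (P0 phi p j.+1) by exact: y_parity_of_x.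
have P1_par : y_parity true (P1 phi q j.+1).
  exact: y_parity_yvar (y_parity_of_x _ _).
have yP0 n k : valid_index d n k ->
    curve_ip I w (yvar phi * Y n k) (P0 phi p j.+1)
    = sumz (j.+1%:Z - d%:Z + 1) (j.+1%:Z + 1)
        (fun r => rr (r - 1) j.+1 * C (2 * r) (l n k)).
  move=> nk; apply: (curve_ip_yvar_P0 mI hw hphi_pos hp hq hphi_deg j.+1
    (D := fun r => C (2 * r) (l n k))) => i.
  exact: (connection_coeff_P1 hC).
have yP1 n k : valid_index d n k ->
    curve_ip I w (yvar phi * Y n k) (P1 phi q j.+1)
    = \sum_(j.+1 - 1 <= r < (j.+1 - 1 + d).+1)
        rr (j.+1%:Z - 1) r * C (2 * r%:Z - 1) (l n k).
  move=> nk; rewrite subn1 (_ : j.+1%:Z - 1 = j%:Z); last by lia.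
  apply: (curve_ip_yvar_P1 mI hw hphi_pos hp hq hphi_deg j
            (D := fun r : nat => C (2 * r%:Z - 1) (l n k))) => i.
  exact: (connection_coeff_P0 hC).
have yrec := y_recurrence mI hw hphi_pos hp hq d2 hY.
have odd_pred k : (0 < k)%N -> odd (k - 1) = ~~ odd k.
  by case: k => // k _; rewrite subn1 /= negbK.
split.
- move=> n nd; split=> k k_odd nk.
  + have nk' : valid_index d n k by rewrite /valid_index; lia.
    rewrite /bx (x_recurrence mI hw hphi_pos hp hq d2 hY nd _ _ P0_par DXE)//.
    rewrite (curve_ip_xvar_P0 mI hw hphi_pos hp).
    rewrite -!(connection_coeff_P0 hC _ nk').
    have -> : 2 * j.+1.-1%:Z - 1 = 2 * j.+1%:Z - 3 :> int by lia.
    by have -> : 2 * j.+2%:Z - 1 = 2 * j.+1%:Z + 1 :> int by lia.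
  + have nk' : valid_index d n k by rewrite /valid_index; lia.
    rewrite /bx (x_recurrence mI hw hphi_pos hp hq d2 hY nd _ _ P1_par DYE).
    2: by lia.
    2: exact/negbTE.
    rewrite (curve_ip_xvar_P1 mI hw hphi_pos hq).
    rewrite -(connection_coeff_P1 hC j nk') -(connection_coeff_P1 hC j.+1 nk').
    rewrite [(j.+1 - 1)%N]subn1.
    have -> : 2 * j.+2%:Z = 2 * j.+1%:Z + 2 :> int by lia.
    have -> : j.+1%:Z - 1 = j%:Z :> int by lia.
    congr (_ + _ + _ - _ - _ - _).
    have -> : j.+1%:Z - 2 = j%:Z - 1 :> int by lia.
    (* At the first row the factor beta (-1) = 0 hides the meaningless P1 q 0. *)
    case: (j) => [|j']; first by rewrite !mul0r.
    rewrite -(connection_coeff_P1 hC j' nk').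
    by have -> : 2 * j'.+2%:Z - 2 = 2 * j'.+1%:Z :> int by lia.
- move=> n k nd ->.
  have nk' : valid_index d n n.+1 by rewrite /valid_index; lia.
  have nK : valid_index d n.+1 n.+2 by rewrite /valid_index; lia.
  have span := yvar_Y_in_span_low mI hw hphi_pos hp hq d2 hY nd nk'.
  have lo : (0 < maxn (n.+1 - 1) 1)%N by lia.
  have lo_le : (if (n <= d - 1)%N then maxn (n.+1 - 1) 1 <= maxn (n.+1 - 1) 1
      else maxn (n.+1 - 1) 1 <= n.+1)%N by case: ifP; lia.
  have e0 : ((n - 1).+1 - d = 0)%N by lia.
  have e1 : (n.+1 - d = 0)%N by lia.
  have e2 : (n.+2 - d = 0)%N by lia.
  have m0 : minn n d = n by lia.
  have m1 : minn n.+1 d = n.+1 by lia.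
  have odd_n1 : odd (n.+1 - 1) = odd n by rewrite subn1.
  have odd_n2 : odd n.+2 = odd n by rewrite /= negbK.
  split=> n_odd.
  + have := yrec _ _ _ _ false (odd n) (odd n) _ _ nk' nK span lo lo_le _ _ _ P0_par DXE.
    rewrite e0 e1 e2 m0 m1 odd_n2 n_odd yP0// => /(_ erefl erefl erefl).
    by rewrite odd_n1 n_odd.
  + have := yrec _ _ _ _ true (odd n) (odd n) _ _ nk' nK span lo lo_le _ _ _ P1_par DYE.
    rewrite e0 e1 e2 m0 m1 odd_n2 (negbTE n_odd) yP1// => /(_ erefl erefl erefl).
    by rewrite odd_n1 (negbTE n_odd).
- move=> n nE.
  have e0 : ((n - 1).+1 - d = 0)%N by lia.
  have e1 : (n.+1 - d = 0)%N by lia.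
  have e2 : (n.+2 - d = 1)%N by lia.
  have m0 : (minn n d).+1 = d by lia.
  have m1 : minn n.+1 d = d by lia.
  have step k : (1 <= k <= d)%N -> [/\ valid_index d n k, valid_index d n.+1 k,
      in_span (previous d Y n.+1 k.+1) (yvar phi * Y n k), (0 < maxn (k - 1) 1)%N
    & (if (n <= d - 1)%N then maxn (k - 1) 1 <= maxn (k - 1) 1
       else maxn (k - 1) 1 <= k)%N].
    move=> kd; have nk : valid_index d n k by rewrite /valid_index; lia.
    split=> //; [by rewrite /valid_index; lia| |by lia|by case: ifP; lia].
    by apply: (yvar_Y_in_span_high mI hw hphi_pos hp hq d2 hY _ nk); lia.
  split=> k k_odd kd.
  + have [|nk nK span lo lo_le] := step k; first by lia.
    have := yrec _ _ _ _ false (odd (k - 1)) (odd (k - 1))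
      _ _ nk nK span lo lo_le _ _ _ P0_par DXE.
    rewrite e0 e1 e2 m0 m1 odd_pred; last by lia.
    by rewrite (negbTE k_odd) yP0// => /(_ erefl erefl erefl).
  + have [|nk nK span lo lo_le] := step k; first by lia.
    have := yrec _ _ _ _ true (odd (k - 1)) (odd (k - 1))
      _ _ nk nK span lo lo_le _ _ _ P1_par DYE.
    rewrite e0 e1 e2 m0 m1 odd_pred; last by lia.
    by rewrite k_odd yP1// => /(_ erefl erefl erefl).
- move=> n k nd kd.
  have nk : valid_index d n k by rewrite /valid_index; lia.
  have nK : valid_index d n.+1 k by rewrite /valid_index; lia.
  have span : in_span (previous d Y n.+1 k.+1) (yvar phi * Y n k).
    by apply: (yvar_Y_in_span_high mI hw hphi_pos hp hq d2 hY _ nk); lia.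
  have lo : (0 < k)%N by lia.
  have lo_le : (if (n <= d - 1)%N then k <= maxn (k - 1) 1 else k <= k)%N.
    by case: ifP; lia.
  have m0 : minn n d = d by lia.
  have m1 : minn n.+1 d = d by lia.
  have e0 : odd ((n - 1).+1 - d) = ~~ odd (n + 1 - d).
    have -> : (n + 1 - d = ((n - 1).+1 - d).+1)%N by lia.
    by rewrite /= negbK.
  have e1 : (n.+1 - d = n + 1 - d)%N by lia.
  have e2 : odd (n.+2 - d) = ~~ odd (n + 1 - d).
    by have -> : (n.+2 - d = (n + 1 - d).+1)%N by lia.
  split=> k_odd.
  + have kE : odd k = odd (n + 1 - d).
      by case: k_odd => [[-> ->]|[/negbTE-> /negbTE->]].
    have c1E : odd k = false (+) ~~ odd ((n - 1).+1 - d) by rewrite e0 negbK kE.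
    have c2E : odd (k - 1) = false (+) ~~ odd (n.+1 - d) by rewrite odd_pred// kE e1.
    have KE : odd k = false (+) ~~ odd (n.+2 - d) by rewrite e2 negbK kE.
    have := yrec _ _ _ _ _ _ _ _ _ nk nK span lo lo_le c1E c2E KE P0_par DXE.
    by rewrite m0 m1 yP0.
  + have kE : odd k = ~~ odd (n + 1 - d).
      by case: k_odd => [[/negbTE-> ->]|[-> /negbTE->]].
    have c1E : odd k = true (+) ~~ odd ((n - 1).+1 - d) by rewrite e0 negbK kE.
    have c2E : odd (k - 1) = true (+) ~~ odd (n.+1 - d) by rewrite odd_pred// kE e1.
    have KE : odd k = true (+) ~~ odd (n.+2 - d) by rewrite e2 negbK kE.
    have := yrec _ _ _ _ _ _ _ _ _ nk nK span lo lo_le c1E c2E KE P1_par DYE.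
    by rewrite m0 m1 yP1.
Qed.
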